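(* Let $G$ be a matroid on $[n]=\{1,\dots,n\}$ with no loops and no multiple points, and fix the natural linear order on $[n]$. Then the collection $\operatorname{nbb}(G)$ of nbb sets of $G$ is a simplicial complex (closed under taking subsets), and it contains the collection $\operatorname{nbc}(G)$ of nbc sets of $G$ as a subcomplex.
   Context: For $X\subseteq[n]$, $\operatorname{cl}(X)=\{i\in[n]: \operatorname{rk}(X\cup\{i\})=\operatorname{rk}(X)\}$ is the matroid closure. A subset $S\subseteq[n]$ is line-closed if $\operatorname{cl}(\{i,j\})\subseteq S$ for all $i,j\in S$. The line-closure $\operatorname{lc}(S)$ of $S$ is the intersection of all line-closed sets containing $S$. A broken circuit is a set $C-\min(C)$ with $C$ a circuit of $G$; an nbc set is a subset of $[n]$ containing no broken circuit. An increasing subset $S=\{i_1<\dots<i_p\}\subseteq[n]$ is nbb if $i_k=\min \operatorname{lc}(\{i_k,\dots,i_p\})$ for every $1\le k\le p$. *)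

(* Defs.v *)
From mathcomp Require Import all_boot.

Set Implicit Arguments.
Unset Strict Implicit.
Unset Printing Implicit Defensive.

Record matroid (T : finType) := Matroid {
  indep : {set {set T}};
  indep0 : set0 \in indep;
  indepS : forall A B : {set T}, A \subset B -> B \in indep -> A \in indep;
  indep_exchange : forall A B : {set T},
    A \in indep -> B \in indep -> #|A| < #|B| ->
    exists2 x, x \in B :\: A & x |: A \in indep
}.

Section Matroid.
Variables (T : finType) (G : matroid T).
Implicit Types (i j : T) (X S C L : {set T}).

Definition rk X : nat := \max_(A in indep G | A \subset X) #|A|.

Definition circuit C : bool := minset [pred D : {set T} | D \notin indep G] C.

Definition loop i : bool := rk [set i] == 0.

Definition parallel i j : bool :=
  [&& i != j, ~~ loop i, ~~ loop j & rk [set i; j] == 1].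

Definition no_loops : Prop := forall i, ~~ loop i.

Definition no_multiple_points : Prop := forall i j, ~~ parallel i j.

Definition cl X : {set T} := [set i | rk (X :|: [set i]) == rk X].

Definition line_closed S : bool :=
  [forall i in S, forall j in S, cl [set i; j] \subset S].

Definition lc S : {set T} :=
  \bigcap_(L : {set T} | line_closed L && (S \subset L)) L.

End Matroid.

(* The empty face is required to belong to a simplicial complex. *)
Definition simplicial_complex (T : finType) (K : {set {set T}}) : Prop :=
  set0 \in K /\
  forall A B : {set T}, A \subset B -> B \in K -> A \in K.

Definition subcomplex (T : finType) (K L : {set {set T}}) : Prop :=
  simplicial_complex K /\ K \subset L.

(* The ground set [n] = {1, ..., n} with its natural order is represented by
   'I_n = {0, ..., n-1}, through the order isomorphism i |-> i - 1. *)
Section Ordered.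
Variables (n : nat) (G : matroid 'I_n).
Implicit Types (i m : 'I_n) (A B C S : {set 'I_n}).

Definition is_min m A : bool := (m \in A) && [forall j in A, m <= j].

Definition broken_circuit B : bool :=
  [exists C : {set 'I_n},
    circuit G C && [exists m, is_min m C && (B == C :\ m)]].

Definition nbc : {set {set 'I_n}} :=
  [set S : {set 'I_n} | [forall B : {set 'I_n}, broken_circuit B ==> ~~ (B \subset S)]].

(* For S = {i_1 < ... < i_p} and i = i_k, the set [set j in S | i <= j] is
   the tail {i_k, ..., i_p}. *)
Definition nbb : {set {set 'I_n}} :=
  [set S : {set 'I_n} | [forall i in S, is_min i (lc G [set j in S | i <= j])]].

End Ordered.

(* Main.v *)
(** Flats are line-closed, so [lc G X] lies in [cl G X].  If [S] is nbc, [i] is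
    in [S] and some [j < i] lies in the line-closure of the tail [X] of [S] from
    [i] on, then [X] is independent while [j |: X] is dependent.  A circuit
    inside [j |: X] has minimum [j], so removing [j] leaves a broken circuit
    inside [S], a contradiction.  Loops must be excluded because a loop makes
    the empty set a broken circuit, so that no set is nbc. *)
Require Import Defs.
From mathcomp Require Import all_boot.

Set Implicit Arguments.
Unset Strict Implicit.
Unset Printing Implicit Defensive.

Section MatroidTheory.
Variables (T : finType) (G : matroid T).
Implicit Types (x y : T) (A I K S X Y C : {set T}).

Lemma leq_card_rk A X : A \in indep G -> A \subset X -> #|A| <= rk G X.
Proof.
by move=> iA sAX; rewrite /rk (@leq_bigmax_cond _ _ (fun A : {set T} => #|A|)) ?iA.
Qed.

Lemma rk_leP X m :
  reflect (forall A, A \in indep G -> A \subset X -> #|A| <= m) (rk G X <= m).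
Proof.
apply: (iffP (bigmax_leqP _ _ _)) => H A; first by move=> iA sA; apply: H; rewrite iA.
by case/andP=> iA sA; apply: H.
Qed.

Lemma rkS X Y : X \subset Y -> rk G X <= rk G Y.
Proof.
by move=> sXY; apply/rk_leP=> A iA sA; apply: leq_card_rk iA (subset_trans sA sXY).
Qed.

Lemma rk_indep X : X \in indep G -> rk G X = #|X|.
Proof.
move=> iX; apply/eqP; rewrite eqn_leq leq_card_rk // andbT.
by apply/rk_leP=> A _; apply: subset_leq_card.
Qed.

(** A maximal independent subset of [X] containing [I] is a basis of [X]: were some independent
    subset larger, the exchange axiom would enlarge it within [X]. *)
Lemma basis_exists I X : I \in indep G -> I \subset X ->
  exists K, [/\ I \subset K, K \in indep G, K \subset X & #|K| = rk G X].
Proof.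
move=> iI sIX; pose P := [pred K : {set T} | (K \in indep G) && (K \subset X)].
have PI : P I by rewrite /= iI.
have [K /maxsetP[/andP[iK sKX] maxK] sIK] := maxset_exists PI.
exists K; split=> //; apply/eqP; rewrite eqn_leq leq_card_rk //=.
apply/rk_leP=> A iA sA; rewrite leqNgt; apply/negP=> ltKA.
have [x /setDP[xA xNK] ixK] := indep_exchange iK iA ltKA.
case/negP: xNK; rewrite -(maxK (x |: K)) ?setU11 ?subsetUr //=.
by rewrite ixK subUset sub1set sKX (subsetP sA).
Qed.

Lemma sub_cl X : X \subset cl G X.
Proof. by apply/subsetP=> x xX; rewrite inE (setUidPl _) // sub1set. Qed.

(** On independent sets rank is cardinality, and adjoining a point of the closure leaves the rank
    unchanged. *)
Lemma cl_indep_dependent X x :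
  X \in indep G -> x \in cl G X -> x \notin X -> x |: X \notin indep G.
Proof.
move=> iX; rewrite inE setUC => /eqP rkE xNX; apply/negP=> ixX.
by move: rkE; rewrite !rk_indep // cardsU1 xNX => /eqP; rewrite eqn_leq ltnn.
Qed.

Lemma rk_cl X : rk G (cl G X) = rk G X.
Proof.
apply/eqP; rewrite eqn_leq (rkS (sub_cl X)) andbT.
have [I [_ iI sIX cI]] := basis_exists (indep0 G) (sub0set X).
apply/rk_leP=> A iA sA; rewrite leqNgt -cI; apply/negP=> ltIA.
have [x /setDP[xA xNI] ixI] := indep_exchange iI iA ltIA.
(* The exchanged point [x] lies in the closure, yet [x |: I] is an independent subset of [x |: X]
   with [rk G X + 1] elements. *)
have := subsetP sA x xA; rewrite inE setUC => /eqP rkE.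
have := leq_card_rk ixI (setUS [set x] sIX).
by rewrite rkE -cI cardsU1 xNI ltnn.
Qed.

(** A basis [I] of [Y] is extended to a basis [K] of [cl G X]. If [z] could be added to [K]
    independently, it could also be added to [I], against [z \in cl G Y]. *)
Lemma cl_sub X Y : Y \subset cl G X -> cl G Y \subset cl G X.
Proof.
move=> sYX; apply/subsetP=> z; rewrite !inE ![_ :|: [set z]]setUC => /eqP rkY.
have [I [_ iI sIY cI]] := basis_exists (indep0 G) (sub0set Y).
have [K [sIK iK sKX cK]] := basis_exists iI (subset_trans sIY sYX).
rewrite eqn_leq andbC rkS ?subsetUr //=.
apply/rk_leP=> A iA sA; rewrite -rk_cl -cK leqNgt; apply/negP=> ltKA.
have [x /setDP[xA xNK] ixK] := indep_exchange iK iA ltKA.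
(* For [x] in [X], the set [x |: K] is too large to be independent in [cl G X]; otherwise [x] is
   [z]. *)
have [xX|xNX] := boolP (x \in X).
  have sxK : x |: K \subset cl G X.
    by rewrite subUset sub1set sKX (subsetP (sub_cl X)).
  by have := leq_card_rk ixK sxK; rewrite -cK cardsU1 xNK ltnn.
have /setU1P[Ex|xX] := subsetP sA x xA; last by rewrite xX in xNX.
have ixI : x |: I \in indep G by apply: indepS ixK; apply: setUS.
have xNI : x \notin I by apply: contra xNK; apply: subsetP.
rewrite Ex in ixI xNI; have := leq_card_rk ixI (setUS [set z] sIY).
by rewrite rkY -cI cardsU1 xNI ltnn.
Qed.

Lemma line_closed_cl X : line_closed G (cl G X).
Proof.
apply/forall_inP=> i iX; apply/forall_inP=> j jX.
by apply: cl_sub; rewrite subUset !sub1set iX.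
Qed.

Lemma sub_lc S : S \subset lc G S.
Proof. by apply/bigcapsP=> L /andP[]. Qed.

Lemma lcS S X : S \subset X -> lc G S \subset lc G X.
Proof.
move=> sSX; apply/bigcapsP=> L /andP[cL sXL]; apply: bigcap_inf.
by rewrite cL (subset_trans sSX).
Qed.

Lemma lc_sub_cl X : lc G X \subset cl G X.
Proof. by apply: bigcap_inf; rewrite line_closed_cl sub_cl. Qed.

Lemma circuit_exists X :
  X \notin indep G -> exists2 C, circuit G C & C \subset X.
Proof.
move=> dX; have [C mC sCX] := @minset_exists _ [pred D | D \notin indep G] X dX.
by exists C.
Qed.

Lemma circuit_dependent C : circuit G C -> C \notin indep G.
Proof. exact: minsetp. Qed.

End MatroidTheory.

Section OrderedMatroid.
Variables (n : nat) (G : matroid 'I_n).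
Implicit Types (A B C S : {set 'I_n}).

Lemma is_min_exists A : A != set0 -> exists m, is_min m A.
Proof.
case/set0Pn=> x xA; case: (arg_minnP (@nat_of_ord n) xA) => m mA mP.
by exists m; rewrite /is_min; apply/andP; split=> //; apply/forall_inP.
Qed.

Lemma nbc_circuitF S C m :
  S \in nbc G -> circuit G C -> is_min m C -> ~~ (C :\ m \subset S).
Proof.
rewrite inE => /forallP/(_ (C :\ m))/implyP nS cC mC; apply: nS.
by apply/existsP; exists C; rewrite cC; apply/existsP; exists m; rewrite mC /=.
Qed.

(** A dependent set contains a circuit, and with it the corresponding broken circuit. *)
Lemma nbc_indep S : S \in nbc G -> S \in indep G.
Proof.
move=> nS; apply: contraT => /circuit_exists[C cC sCS].
have /is_min_exists[m mC] : C != set0.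
  by apply: contraNneq (circuit_dependent cC) => ->; apply: indep0.
case/negP: (nbc_circuitF nS cC mC).
by apply: subset_trans sCS; apply: subsetDl.
Qed.

Lemma nbcS A B : A \subset B -> B \in nbc G -> A \in nbc G.
Proof.
move=> sAB; rewrite !inE => /forall_inP nB; apply/forall_inP=> D bD.
by apply: contra (nB D bD) => sDA; apply: subset_trans sDA sAB.
Qed.

Lemma nbc0 : no_loops G -> set0 \in nbc G.
Proof.
move=> nl; rewrite inE; apply/forall_inP=> D /existsP[C /andP[cC /existsP[m]]].
(* An empty broken circuit forces [C] into [[set m]]. Then [m] is a loop: a nonempty independent
   subset of [[set m]] would contain the dependent set [C]. *)
case/andP=> _ /eqP->; apply/negP; rewrite subset0 setD_eq0 => sCm.
case/negP: (nl m); rewrite /loop -leqn0.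
apply/rk_leP=> A iA sA; rewrite leqn0 cards_eq0; apply: contraT => A0.
case/negP: (circuit_dependent cC); apply: indepS iA.
by move: sA; rewrite subset1 (negPf A0) orbF => /eqP->.
Qed.

Lemma nbb0 : set0 \in nbb G.
Proof. by rewrite inE; apply/forall_inP=> i; rewrite inE. Qed.

(** Each tail of [A] lies in the tail of [B] from the same point, so by monotonicity of [lc] the
    minimality of that point is inherited. *)
Lemma nbbS A B : A \subset B -> B \in nbb G -> A \in nbb G.
Proof.
move=> sAB; rewrite !inE => /forall_inP nB; apply/forall_inP=> i iA.
have /andP[_ /forall_inP minB] := nB i (subsetP sAB i iA).
rewrite /is_min (subsetP (sub_lc G _)) ?inE ?iA //=.
apply/forall_inP=> j jlc; apply: minB; apply: subsetP jlc; apply: lcS.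
by apply/subsetP=> k; rewrite !inE => /andP[/(subsetP sAB)->].
Qed.

Lemma nbc_sub_nbb : nbc G \subset nbb G.
Proof.
apply/subsetP=> S nS; rewrite inE; apply/forall_inP=> i iS.
set X := [set j in S | i <= j].
have sXS : X \subset S by apply/subsetP=> j; rewrite inE => /andP[].
rewrite /is_min (subsetP (sub_lc G _)) ?inE ?iS //=.
apply/forall_inP=> j /(subsetP (lc_sub_cl G X)) jcl.
rewrite leqNgt; apply/negP=> ltji.
have jNX : j \notin X by rewrite inE leqNgt ltji andbF.
have iX := nbc_indep (nbcS sXS nS).
have [C cC sC] := circuit_exists (cl_indep_dependent iX jcl jNX).
(* If [C] avoided [j], it would lie in the independent set [X]. *)
have jC : j \in C.
  apply: contraR (circuit_dependent cC) => jNC; apply: indepS iX.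
  by rewrite -(setU1K jNX) subsetD1 sC.
(* Every other element of [C] lies in [X], hence is at least [i], which exceeds [j]. *)
have minj : is_min j C.
  rewrite /is_min jC; apply/forall_inP=> k /(subsetP sC) /setU1P[->|] //.
  by rewrite inE => /andP[_]; apply: leq_trans (ltnW ltji).
case/negP: (nbc_circuitF nS cC minj); apply: subset_trans sXS.
by rewrite subDset.
Qed.

End OrderedMatroid.

Theorem theorem2p11 (n : nat) (G : matroid 'I_n)
    (hloop : no_loops G) (hmult : no_multiple_points G) :
  simplicial_complex (nbb G) /\ subcomplex (nbc G) (nbb G).
Proof.
split; first by split; [exact: nbb0 | exact: nbbS].
by split; [split; [exact: nbc0 | exact: nbcS] | exact: nbc_sub_nbb].
Qed.
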